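(* Let $\Phi_P := \{ \mathbf{x} \in \mathbb{R}^2 \mid A\mathbf{x} - \mathbf{b} \in \mathcal{Q}^3 \}$ and consider the problem (P) of minimizing $x_1 + x_2$ over $\mathbf{x} = (x_1,x_2) \in \Phi_P$. The optimal value of (P) is $\operatorname{val}(P) = 0$, but there exists no feasible point $\mathbf{x} \in \Phi_P$ such that $x_1 + x_2 = 0$. Therefore, (P) is not solvable (it has no optimal solution).
   Context: The linear operator $A:\mathbb{R}^2\to\mathbb{R}^3$ and the vector $\mathbf{b}\in\mathbb{R}^3$ are $$A = \begin{pmatrix}0 & 0\\ 0 & 1\\ 1 & 0\end{pmatrix},\qquad \mathbf{b} = \begin{pmatrix}-1\\0\\0\end{pmatrix},$$ and the second-order cone in $\mathbb{R}^3$ is $\mathcal{Q}^3 = \{\mathbf{y} = (y_1,y_2,y_3)\in\mathbb{R}^3 \mid y_3 \ge \sqrt{y_1^2+y_2^2}\}$. The optimal value is $\operatorname{val}(P) = \inf\{x_1+x_2 \mid \mathbf{x}\in\Phi_P\}$. The problem (P) is solvable if this infimum is attained at some point of $\Phi_P$. *)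

(* Defs.v *)
From mathcomp Require Import all_boot all_order all_algebra.
From mathcomp Require Import classical_sets reals constructive_ereal ereal.

Set Implicit Arguments.
Unset Strict Implicit.
Unset Printing Implicit Defensive.

Import Order.TTheory GRing.Theory Num.Theory.

Local Open Scope classical_set_scope.
Local Open Scope ring_scope.

Section SecondOrderConeProgram.
Variable R : realType.

(* Vectors are columns and coordinates are numbered from 0, so that the
   entry [x i 0] is the coordinate usually written x_(i+1). *)

Definition matA : 'M[R]_(3, 2) :=
  \matrix_(i, j) (nth [::] [:: [:: 0; 0];
                               [:: 0; 1];
                               [:: 1; 0]] i)`_j.

Definition vecb : 'cV[R]_3 := \col_i [:: -1; 0; 0]`_i.

Definition soc3 : set 'cV[R]_3 :=
  [set y | Num.sqrt (y 0 0 ^+ 2 + y 1 0 ^+ 2) <= y 2 0].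

Definition feasible : set 'cV[R]_2 := [set x | soc3 (matA *m x - vecb)].

Definition objective (x : 'cV[R]_2) : R := x 0 0 + x 1 0.

(* The infimum is taken in the extended reals, so that it is meaningful
   without knowing beforehand that the problem is feasible and bounded below. *)
Definition optval : \bar R := ereal_inf [set (objective x)%:E | x in feasible].

Definition solvable : Prop :=
  exists x, feasible x /\ (objective x)%:E = optval.

End SecondOrderConeProgram.

(* Main.v *)
Require Import Defs.
From mathcomp Require Import all_boot all_order all_algebra.
From mathcomp Require Import classical_sets reals constructive_ereal ereal.
From mathcomp Require Import ring lra.

(** Since [matA *m x - vecb] is the column (1, x_2, x_1), the feasible set is
    the region x_1 >= sqrt (1 + x_2 ^ 2) inside one branch of a hyperbola
    ([feasibleE]).  The line x_1 + x_2 = 0 is an asymptote of that branch: the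
    1 under the root keeps every feasible point strictly above the line
    ([objective_gt0]), but feasible points come arbitrarily close to it
    ([objective_attains]).  So the objective takes exactly the positive values
    on the feasible set, and its infimum 0 is not attained. *)

Import Order.TTheory GRing.Theory Num.Theory.

Local Open Scope ring_scope.

Lemma feasibleE (R : realType) (x : 'cV[R]_2) :
  feasible x <-> Num.sqrt (1 + x 1 0 ^+ 2) <= x 0 0.
Proof.
rewrite /feasible /soc3 /= !mxE !big_ord_recl !big_ord0 !mxE /=.
(* The sums index the rows of [x] by [ord0] and its lift, which match 0 and 1
   only up to the proof component of an ordinal. *)
have -> : lift ord0 ord0 = 1 :> 'I_2 by exact: val_inj.
have -> : ord0 = 0 :> 'I_2 by exact: val_inj.
by rewrite !mul0r !mul1r !addr0 !add0r opprK !subr0 expr1n.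
Qed.

Lemma objective_gt0 (R : realType) (x : 'cV[R]_2) :
  feasible x -> 0 < objective x.
Proof.
move=> /feasibleE x_feas; rewrite /objective -ltrBlDr sub0r.
apply: lt_le_trans x_feas; apply: le_lt_trans (ler_norm _) _.
by rewrite normrN -sqrtr_sqr ltr_sqrt ?ltrDr // ltr_wpDr ?sqr_ge0.
Qed.

(** The witness is (e + 1 / e, - 1 / e): its objective is e, and it is feasible
    because (e + 1 / e) ^ 2 = e ^ 2 + 2 + (1 / e) ^ 2 exceeds
    1 + (1 / e) ^ 2. *)
Lemma objective_attains (R : realType) (e : R) :
  0 < e -> exists2 x : 'cV[R]_2, feasible x & objective x = e.
Proof.
move=> e_gt0; have e_neq0 : e != 0 by rewrite gt_eqF.
have V_gt0 : 0 < e^-1 by rewrite invr_gt0.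
exists (\col_i [:: e + e^-1; - e^-1]`_i); last by rewrite /objective !mxE /= addrK.
apply/feasibleE; rewrite !mxE /= sqrrN.
have sum_ge0 : 0 <= e + e^-1 by rewrite ltW ?addr_gt0.
rewrite -[leRHS](ger0_norm sum_ge0) -sqrtr_sqr; apply: ler_wsqrtr.
have -> : (e + e^-1) ^+ 2 = e ^+ 2 + 2 + e^-1 ^+ 2 by field.
by have := sqr_ge0 e; lra.
Qed.

Lemma optval_eq0 (R : realType) : optval R = 0%:E.
Proof.
apply/eqP; rewrite eq_le; apply/andP; split.
  apply/lee_addgt0Pr => e /objective_attains [x x_feas <-].
  by rewrite add0e; apply: ereal_inf_lbound; exists x.
by apply: le_ereal_inf_tmp => _ [x /objective_gt0/ltW x_ge0 <-]; rewrite lee_fin.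
Qed.

Theorem lemma3p4 (R : realType) :
  [/\ optval R = 0%:E,
      ~ (exists x : 'cV[R]_2, feasible x /\ x 0 0 + x 1 0 = 0)
    & ~ solvable R].
Proof.
have no_zero : ~ (exists x : 'cV[R]_2, feasible x /\ x 0 0 + x 1 0 = 0).
  by case=> x [/objective_gt0 + x_eq0]; rewrite /objective x_eq0 ltxx.
split=> //; first exact: optval_eq0.
case=> x [x_feas]; rewrite optval_eq0 => -[x_eq0].
by apply: no_zero; exists x.
Qed.
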